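(* Let $k$ and $s$ be positive integers, let $\Delta$ be a $k$-dimensional simplicial complex on $[s]=\{1,\dots,s\}$, and let $I_\Delta$ be its Stanley-Reisner ideal in the polynomial ring $S=\mathbb{K}[x_1,\dots,x_s]$ over a field $\mathbb{K}$. Then $$a_{k+1}(S/I_\Delta^{(n)})=a_{k+1}(S/I_\Delta^{n})$$ for all $n\ge 1$.
   Context: A simplicial complex on $[s]$ is a collection $\Delta$ of subsets (faces) of $[s]$ closed under taking subsets; $\dim F=|F|-1$ for a face $F$, and $\dim\Delta=\max\{\dim F: F\in\Delta\}$. $\mathcal{F}(\Delta)$ is the set of facets (inclusion-maximal faces). For $F\subseteq[s]$ put $\mathbf{x}_F=\prod_{i\in F}x_i$. The Stanley-Reisner ideal $I_\Delta\subseteq S$ is generated by the $\mathbf{x}_F$ with $F\subseteq [s]$ a minimal non-face of $\Delta$. The $n$-th symbolic power is $I_\Delta^{(n)}=\bigcap_{F\in\mathcal{F}(\Delta)}P_F^n$, where $P_F=(x_i: i\in[s]\setminus F)$. With $\mathfrak{m}=(x_1,\dots,x_s)$ and $S$ standard graded, the $a_i$-invariant of a finitely generated graded $S$-module $M$ is $a_i(M)=\max\{t\in\mathbb{Z}: H^i_{\mathfrak{m}}(M)_t\ne0\}$, where $H^i_{\mathfrak{m}}(M)$ is local cohomology. *)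

(* Defs.v *)
(* mpoly has to be imported before the mathcomp-analysis files: their notations
   clash in the other order. *)
From HB Require Import structures.
From mathcomp Require Import all_boot all_order all_algebra.
From mathcomp Require Import mpoly.
From mathcomp Require Import zify.
From mathcomp Require Import boolp constructive_ereal.

Set Implicit Arguments.
Unset Strict Implicit.
Unset Printing Implicit Defensive.

Import Order.TTheory GRing.Theory Num.Theory.
Local Open Scope ring_scope.
Local Open Scope quotient_scope.

Section QuotientModule.
Variables (R : nzRingType) (V : lmodType R) (W : submodClosed V).

(* [submodClosed] does not inherit from [zmodClosed], which the quotients of
   ring_quotient require. *)
Definition submodule : {pred V} := W.

Fact submodule_closed : zmod_closed submodule.
Proof. exact: GRing.submod_closedB (submodClosedP W). Qed.

HB.instance Definition _ :=
  GRing.isZmodClosed.Build V submodule submodule_closed.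

Definition quot_mod := {ideal_quot submodule}.

HB.instance Definition _ :=
  EqQuotient.copy quot_mod {ideal_quot submodule}.
HB.instance Definition _ :=
  ZmodQuotient.copy quot_mod {ideal_quot submodule}.

Definition quot_scale (a : R) (x : quot_mod) : quot_mod :=
  \pi_quot_mod (a *: repr x).

Lemma quot_scaleE a (v : V) :
  quot_scale a (\pi_quot_mod v) = \pi_quot_mod (a *: v).
Proof.
apply/eqP; rewrite -Quotient.idealrBE -scalerBr.
have : repr (\pi_quot_mod v) - v \in submodule.
  by rewrite Quotient.idealrBE reprK.
exact: rpredZ.
Qed.

Fact quot_scaleA a b x : quot_scale a (quot_scale b x) = quot_scale (a * b) x.
Proof.
by elim/quotW: x => v; rewrite (quot_scaleE b v) !quot_scaleE scalerA.
Qed.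

Fact quot_scale1 : left_id 1 quot_scale.
Proof. by elim/quotW=> v; rewrite quot_scaleE scale1r. Qed.

Fact quot_scaleDr : right_distributive quot_scale +%R.
Proof.
move=> a; elim/quotW=> u; elim/quotW=> v.
by rewrite -raddfD !quot_scaleE scalerDr raddfD.
Qed.

Fact quot_scaleDl x : {morph quot_scale^~ x : a b / a + b}.
Proof.
by elim/quotW: x => v a b; rewrite !quot_scaleE scalerDl raddfD.
Qed.

HB.instance Definition _ := GRing.Zmodule_isLmodule.Build R quot_mod
  quot_scaleA quot_scale1 quot_scaleDr quot_scaleDl.

End QuotientModule.

(* The ideals of a commutative ring [A] are the submodules of [A^o]. *)
Section Ideals.
Variable A : comNzRingType.

Definition ideal_gen (G : A -> Prop) : {pred A^o} := fun f =>
  `[< exists (r : nat) (a g : 'I_r -> A),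
        (forall i, G (g i)) /\ f = \sum_(i < r) a i * g i >].

Lemma ideal_gen_closed (G : A -> Prop) : submod_closed (ideal_gen G).
Proof.
split=> [|c u v /asboolP[r [a [g [Gg ->]]]] /asboolP[q [b [h [Gh ->]]]]].
  apply/asboolP; exists 0%N, (fun=> 0), (fun=> 0).
  by split=> [[]//|]; rewrite big_ord0.
apply/asboolP; exists (r + q)%N.
exists (fun i => match split i with inl j => c * a j | inr j => b j end).
exists (fun i => match split i with inl j => g j | inr j => h j end).
split=> [i|]; first by case: (split i).
rewrite big_split_ord /= /GRing.scale /= mulr_sumr.
congr (_ + _); apply: eq_bigr => i _.
  by rewrite (unsplitK (inl i)) mulrA.
by rewrite (unsplitK (inr i)).
Qed.

HB.instance Definition _ G :=
  GRing.isSubmodClosed.Build A A^o (ideal_gen G) (ideal_gen_closed G).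

Definition ideal_pow (J : {pred A^o}) (n : nat) : {pred A^o} :=
  ideal_gen (fun f =>
    exists2 g : 'I_n -> A, (forall i, g i \in J) & f = \prod_(i < n) g i).

HB.instance Definition _ J n := GRing.SubmodClosed.on (ideal_pow J n).

End Ideals.

(* The localization [M_f] of a module [M] at the powers of [f]: the pair
   [(m, a)] represents the fraction [m / f ^ a]. *)
Section Localization.
Variables (A : comNzRingType) (M : lmodType A) (f : A).

Definition loc_equiv (u v : M * nat) : bool :=
  `[< exists c, f ^+ (c + v.2) *: u.1 = f ^+ (c + u.2) *: v.1 >].

Lemma loc_equiv_class : equiv_class_of loc_equiv.
Proof.
split=> [u|u v|v u w].
- by apply/asboolP; exists 0%N.
- by apply/asboolP/asboolP => -[c e]; exists c; rewrite e.
- move=> /asboolP[c e] /asboolP[d e']; apply/asboolP; exists (c + d + v.2)%N.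
  have -> : (c + d + v.2 + w.2 = (d + w.2) + (c + v.2))%N by lia.
  rewrite exprD -scalerA e scalerA mulrC -scalerA e' scalerA -exprD.
  by congr (_ ^+ _ *: _); lia.
Qed.

Canonical loc_equivR := EquivRelPack loc_equiv_class.
Canonical loc_encModRel := defaultEncModRel loc_equiv.

Definition loc := {eq_quot loc_equiv}.
HB.instance Definition _ : EqQuotient (M * nat)%type loc_equiv loc :=
  EqQuotient.on loc.
HB.instance Definition _ := Choice.on loc.

Definition loc_frac (m : M) (a : nat) : loc := \pi_loc (m, a).

Lemma loc_frac_eqP m a m' a' :
  loc_frac m a = loc_frac m' a' <->
  exists c, f ^+ (c + a') *: m = f ^+ (c + a) *: m'.
Proof.
rewrite /loc_frac; split=> [/eqP|h]; last first.
  by apply/eqP; rewrite piE; apply/asboolP.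
by rewrite piE => /asboolP.
Qed.

Lemma loc_fracP (z : loc) : exists m a, z = loc_frac m a.
Proof.
exists (repr z).1, (repr z).2.
by rewrite /loc_frac -surjective_pairing reprK.
Qed.

Definition loc_zero : loc := loc_frac 0 0.
Definition loc_opp (z : loc) : loc := loc_frac (- (repr z).1) (repr z).2.
Definition loc_add (y z : loc) : loc :=
  loc_frac (f ^+ (repr z).2 *: (repr y).1 + f ^+ (repr y).2 *: (repr z).1)
    ((repr y).2 + (repr z).2)%N.

Lemma repr_loc_frac m a : exists c,
  f ^+ (c + a) *: (repr (loc_frac m a)).1 =
  f ^+ (c + (repr (loc_frac m a)).2) *: m.
Proof. by apply/loc_frac_eqP; rewrite /loc_frac -surjective_pairing reprK. Qed.

Lemma loc_oppE m a : loc_opp (loc_frac m a) = loc_frac (- m) a.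
Proof.
apply/loc_frac_eqP; have [c e] := repr_loc_frac m a; exists c.
by rewrite !scalerN e.
Qed.

Lemma loc_addE m a n b :
  loc_add (loc_frac m a) (loc_frac n b) =
  loc_frac (f ^+ b *: m + f ^+ a *: n) (a + b)%N.
Proof.
apply/loc_frac_eqP.
have [c] := repr_loc_frac m a; have [d] := repr_loc_frac n b.
move: (repr (loc_frac m a)) (repr (loc_frac n b)).
move=> [m' a'] [n' b'] /= e' e.
exists (c + d)%N; rewrite !scalerDr !scalerA -!exprD; congr (_ + _).
  have -> : (c + d + (a + b) + b' = d + b + b' + (c + a))%N by lia.
  by rewrite exprD -scalerA e scalerA -exprD; congr (_ ^+ _ *: _); lia.
have -> : (c + d + (a + b) + a' = c + a + a' + (d + b))%N by lia.
by rewrite exprD -scalerA e' scalerA -exprD; congr (_ ^+ _ *: _); lia.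
Qed.

Fact loc_addA : associative loc_add.
Proof.
move=> x y z; have [m [a ->]] := loc_fracP x; have [n [b ->]] := loc_fracP y.
have [p [c ->]] := loc_fracP z; rewrite !loc_addE; congr loc_frac; last by lia.
rewrite !scalerDr !scalerA -!exprD addrA.
by congr (_ ^+ _ *: _ + _ ^+ _ *: _ + _ ^+ _ *: _); lia.
Qed.

Fact loc_addC : commutative loc_add.
Proof.
move=> x y; have [m [a ->]] := loc_fracP x; have [n [b ->]] := loc_fracP y.
by rewrite !loc_addE addrC addnC.
Qed.

Fact loc_add0 : left_id loc_zero loc_add.
Proof.
move=> x; have [m [a ->]] := loc_fracP x.
by rewrite loc_addE scaler0 add0r scale1r.
Qed.

Fact loc_addN : left_inverse loc_zero loc_opp loc_add.
Proof.
move=> x; have [m [a ->]] := loc_fracP x; rewrite loc_oppE loc_addE.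
by rewrite scalerN addNr; apply/loc_frac_eqP; exists 0%N; rewrite !scaler0.
Qed.

HB.instance Definition _ :=
  GRing.isZmodule.Build loc loc_addA loc_addC loc_add0 loc_addN.

End Localization.

(* For [g = h * f], the canonical map [M_f -> M_g] sending [m / f^a] to
   [h^a m / g^a]. *)
Definition loc_map (A : comNzRingType) (M : lmodType A) (f g h : A)
    (z : loc M f) : loc M g :=
  loc_frac g (h ^+ (repr z).2 *: (repr z).1) (repr z).2.

Lemma loc_mapE (A : comNzRingType) (M : lmodType A) (f g h : A) (m : M) a :
  g = h * f -> loc_map g h (loc_frac f m a) = loc_frac g (h ^+ a *: m) a.
Proof.
move=> ->; apply/loc_frac_eqP; have [c] := repr_loc_frac f m a.
move: (repr _) => [m' a'] /= e; exists c.
have E u v : (h * f) ^+ (c + u) * h ^+ v = h ^+ (c + u + v) * f ^+ (c + u).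
  by rewrite exprMn [h ^+ (_ + v)]exprD mulrAC.
by rewrite !scalerA !E -!scalerA e addnAC.
Qed.

Section LocalCohomology.
Variables (K : fieldType) (s : nat).
Local Notation S := {mpoly K[s]}.

Definition xprod (F : {set 'I_s}) : S := \prod_(i in F) 'X_i.

Section Cech.
Variables (M : lmodType S) (gr : int -> M -> Prop).

(* The Cech complex of [M] on [x_1, .., x_s], with the summands
   [M_{x_F}], [#|F| = p], in cohomological degree [p]; a cochain is given
   together with its (zero) components in the other degrees. *)
Definition cochain := forall F : {set 'I_s}, loc M (xprod F).

Definition cech_d (c : cochain) : cochain := fun G =>
  \sum_(i in G) loc_map (xprod G) 'X_i (c (G :\ i))
     *~ (-1) ^+ #|[set j in G | (j < i)%N]|.

Definition in_degree (p : nat) (c : cochain) : Prop :=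
  forall F : {set 'I_s}, #|F| != p -> c F = 0.

(* [m / x_F ^ a] has internal degree [t] when [m] has degree [t + a * #|F|]. *)
Definition homogeneous (t : int) (c : cochain) : Prop :=
  forall F : {set 'I_s}, exists m a,
    gr (t + (a * #|F|)%:Z) m /\ c F = loc_frac (xprod F) m a.

Definition cocycle i t (c : cochain) : Prop :=
  [/\ in_degree i c, homogeneous t c & forall G, cech_d c G = 0].

(* [b] is a cochain of degree [i - 1]; for [i = 0] this forces [b = 0]. *)
Definition coboundary i t (c : cochain) : Prop :=
  exists b : cochain,
    [/\ forall F : {set 'I_s}, #|F|.+1 != i -> b F = 0, homogeneous t b &
        forall G, c G = cech_d b G].

(* [H^i_m(M)_t <> 0], for the grading of [M] with [gr t] the degree [t] part *)
Definition local_cohomology_neq0 (i : nat) (t : int) : Prop :=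
  exists2 c, cocycle i t c & ~ coboundary i t c.

Definition a_max (i : nat) (t : int) : Prop :=
  local_cohomology_neq0 i t /\
  forall u, local_cohomology_neq0 i u -> u <= t.

(* The maximum of the empty set is [-oo]; the value [+oo] would stand for a set
   of degrees without upper bound. *)
Definition a_inv (i : nat) : \bar int :=
  match pselect (exists t, a_max i t) with
  | left h => (projT1 (cid h))%:E
  | right _ =>
      if `[< exists t, local_cohomology_neq0 i t >] then +oo%E else -oo%E
  end.

End Cech.

Definition mpoly_deg (t : int) (f : S) : Prop :=
  match t with
  | Posz d => f \is d.-homog
  | Negz _ => f = 0
  end.

(* For a homogeneous ideal [J], the standard grading of [S / J]. *)
Definition quot_deg (J : submodClosed S^o) (t : int) (x : quot_mod J) : Prop :=
  exists2 f : S, mpoly_deg t f & x = \pi_(quot_mod J) f.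

End LocalCohomology.

Section SimplicialComplexes.
Variables (s : nat) (D : {set {set 'I_s}}).

Definition simplicial_complex : Prop :=
  forall F G : {set 'I_s}, F \in D -> G \subset F -> G \in D.

Definition face_dim (F : {set 'I_s}) : int := #|F|%:Z - 1.

Definition complex_dim : int := \big[Order.max/(-1)]_(F in D) face_dim F.

Definition facets : {set {set 'I_s}} := [set F | maxset (fun G => G \in D) F].

Definition min_nonfaces : {set {set 'I_s}} :=
  [set F | minset (fun G => G \notin D) F].

End SimplicialComplexes.

Section StanleyReisner.
Variables (K : fieldType) (s : nat) (D : {set {set 'I_s}}).
Local Notation S := {mpoly K[s]}.

Definition stanley_reisner : {pred S^o} :=
  ideal_gen (fun f : S => exists2 F, F \in min_nonfaces D & f = xprod K F).

HB.instance Definition _ := GRing.SubmodClosed.on stanley_reisner.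

Definition facet_prime (F : {set 'I_s}) : {pred S^o} :=
  ideal_gen (fun f : S => exists2 i, i \notin F & f = 'X_i).

Definition symbolic_power (n : nat) : {pred S^o} := fun f =>
  [forall (F | F \in facets D), f \in ideal_pow (facet_prime F) n].

Lemma symbolic_power_closed n : submod_closed (symbolic_power n).
Proof.
split=> [|c u v /forall_inP uI /forall_inP vI]; apply/forall_inP => F FD.
  exact: rpred0.
by apply: rpredD; [apply: rpredZ; apply: uI | apply: vI].
Qed.

HB.instance Definition _ n :=
  GRing.isSubmodClosed.Build S S^o (symbolic_power n) (symbolic_power_closed n).

End StanleyReisner.

Arguments quot_deg {K s} J t x.
Arguments stanley_reisner K {s} D.
Arguments facet_prime K {s} F.
Arguments symbolic_power K {s} D n.

(* Main.v *)
(* Localizing at x_F with |F| >= k + 1 makes I^n and I^(n) equal: if F is not a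
   face then x_F is in I, and otherwise F is a facet and x_F P_F is contained
   in I, so that x_F^n I^(n) is contained in x_F^n P_F^n and hence in I^n.
   So the map from the Cech complex of S/I^n to that of S/I^(n) is bijective in
   degrees >= k + 1; being also onto in degree k, it induces an isomorphism on
   H^(k+1). *)
Require Import Defs.
From HB Require Import structures.
From mathcomp Require Import all_boot all_order all_algebra.
From mathcomp Require Import mpoly.
From mathcomp Require Import boolp constructive_ereal.

Set Implicit Arguments.
Unset Strict Implicit.
Unset Printing Implicit Defensive.

Import Order.TTheory GRing.Theory Num.Theory.
Local Open Scope ring_scope.
Local Open Scope quotient_scope.

(** * Quotient modules and the maps induced by inclusions of submodules *)

Section Quotient.
Variables (R : nzRingType) (V : lmodType R) (W : submodClosed V).

Lemma quot_pi_eq (u v : V) :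
  (\pi_(quot_mod W) u = \pi_(quot_mod W) v) <-> (u - v \in W).
Proof.
split=> [/eqP|h]; first by rewrite -Quotient.idealrBE.
by apply/eqP; rewrite -Quotient.idealrBE.
Qed.

Lemma quot_pi0 (u : V) : (\pi_(quot_mod W) u = 0) <-> (u \in W).
Proof.
have -> : 0 = \pi_(quot_mod W) 0 by rewrite raddf0.
by rewrite quot_pi_eq subr0.
Qed.

Lemma quot_piZ (a : R) (v : V) :
  a *: \pi_(quot_mod W) v = \pi_(quot_mod W) (a *: v).
Proof. exact: quot_scaleE. Qed.

End Quotient.

Section QuotientMap.
Variables (R : nzRingType) (V : lmodType R) (W W' : submodClosed V).

(** The inclusion [sub] is an argument so that the linear structure declared below can be found from
    the term [quot_map sub]. *)
Definition quot_map (sub : {subset W <= W'}) (x : quot_mod W) : quot_mod W' :=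
  \pi_(quot_mod W') (repr x).

Variable sub : {subset W <= W'}.

Lemma quot_mapE v : quot_map sub (\pi_(quot_mod W) v) = \pi_(quot_mod W') v.
Proof.
by rewrite /quot_map; apply/quot_pi_eq/sub/quot_pi_eq; rewrite reprK.
Qed.

Fact quot_map_linear : linear (quot_map sub).
Proof.
move=> a; elim/quotW=> u; elim/quotW=> v.
by rewrite quot_piZ -raddfD !quot_mapE raddfD quot_piZ.
Qed.

HB.instance Definition _ :=
  GRing.isLinear.Build R (quot_mod W) (quot_mod W') _ (quot_map sub)
    quot_map_linear.

End QuotientMap.

(** * Localization as a functor on linear maps *)

Lemma loc_frac_eq0 (A : comNzRingType) (M : lmodType A) (f : A) (m : M) a :
  loc_frac f m a = 0 <-> exists c, f ^+ c *: m = 0.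
Proof.
apply: (iff_trans (loc_frac_eqP f m a 0 0)).
by split=> -[c e]; exists c; move: e; rewrite addn0 scaler0.
Qed.

Section LocalizedMap.
Variables (A : comNzRingType) (M M' : lmodType A) (q : {linear M -> M'}).

Definition loc_lin (f : A) (z : loc M f) : loc M' f :=
  loc_frac f (q (repr z).1) (repr z).2.

Lemma loc_linE f m a : loc_lin (loc_frac f m a) = loc_frac f (q m) a.
Proof.
apply/loc_frac_eqP; have [c e] := repr_loc_frac f m a.
by exists c; rewrite -!linearZ e.
Qed.

Fact loc_lin_additive f : {morph @loc_lin f : y z / y - z}.
Proof.
move=> y z; have [m [a ->]] := loc_fracP y; have [n [b ->]] := loc_fracP z.
(* Subtraction in the localization is by definition [loc_add] with [loc_opp], whose values on
   fractions are known. *)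
have subE (N : lmodType A) (u v : N) :
    loc_frac f u a - loc_frac f v b =
    loc_frac f (f ^+ b *: u + f ^+ a *: (- v)) (a + b)%N.
  rewrite -loc_addE -loc_oppE; reflexivity.
by rewrite subE !loc_linE subE linearD !linearZ linearN.
Qed.

HB.instance Definition _ f :=
  GRing.isZmodMorphism.Build (loc M f) (loc M' f) (@loc_lin f)
    (@loc_lin_additive f).

Lemma loc_lin_map (f g h : A) (z : loc M f) : g = h * f ->
  loc_lin (loc_map g h z) = loc_map g h (loc_lin z).
Proof.
move=> gE; have [m [a ->]] := loc_fracP z.
by rewrite loc_mapE // !loc_linE loc_mapE // linearZ.
Qed.

(** If q(m)/f^a = 0, then f^c m lies in the kernel of [q] for some c; a further power of f kills it,
    so m/f^a = 0. *)
Lemma loc_lin_inj f :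
    (forall m, q m = 0 -> exists c, f ^+ c *: m = 0) ->
  injective (@loc_lin f).
Proof.
move=> kerq; apply: raddf_inj => z; have [m [a ->]] := loc_fracP z.
rewrite /= loc_linE => /loc_frac_eq0[c]; rewrite -linearZ => /kerq[d e].
by apply/loc_frac_eq0; exists (d + c)%N; rewrite exprD -scalerA.
Qed.

End LocalizedMap.

(** * Comparison of Cech complexes along a graded surjection *)

Section CechComparison.
Variables (K : fieldType) (s : nat).
Local Notation S := {mpoly K[s]}.

Lemma cech_d_in_degree (M : lmodType S) (b : cochain M) p :
  (forall F : {set 'I_s}, #|F|.+1 != p -> b F = 0) -> in_degree p (cech_d b).
Proof.
move=> b_p G Gp; rewrite /cech_d big1 // => i iG; rewrite b_p; last first.
  by apply: contraNneq Gp => <-; rewrite [X in X == _](cardsD1 i) iG.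
rewrite [0](_ : _ = loc_frac _ 0 0) // loc_mapE; last exact: big_setD1.
rewrite scaler0 [loc_frac _ _ _](_ : _ = 0) ?mul0rz //.
Qed.

Variables (M M' : lmodType S) (q : {linear M -> M'}).
Variables (gr : int -> M -> Prop) (gr' : int -> M' -> Prop).

Lemma cech_d_loc_lin (c : cochain M) G :
  loc_lin q (cech_d c G) = cech_d (fun F => loc_lin q (c F)) G.
Proof.
rewrite /cech_d raddf_sum; apply: eq_bigr => i iG.
by rewrite raddfMz /= loc_lin_map //; apply: big_setD1.
Qed.

Hypothesis gr0 : forall t, gr t 0.
Hypothesis q_gr : forall t m, gr t m -> gr' t (q m).
Hypothesis q_onto : forall t m', gr' t m' -> exists2 m, gr t m & m' = q m.

Lemma homogeneous_loc_lin t (c : cochain M) :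
  homogeneous gr t c -> homogeneous gr' t (fun F => loc_lin q (c F)).
Proof.
move=> hc F; have [m [a [mt ->]]] := hc F.
by exists (q m), a; split; [apply: q_gr | rewrite loc_linE].
Qed.

(** Each component is lifted separately: its numerator is lifted in the same degree and the
    denominator is kept. Outside [P] the lift is chosen to be 0, so that the cohomological degree is
    preserved. *)
Lemma homogeneous_lift t (P : pred {set 'I_s}) (c' : cochain M') :
    homogeneous gr' t c' -> (forall F, ~~ P F -> c' F = 0) ->
  exists c : cochain M, [/\ homogeneous gr t c, forall F, ~~ P F -> c F = 0
    & forall F, loc_lin q (c F) = c' F].
Proof.
move=> hc' c'0.
have lift F : {z : loc M (xprod K F) |
    [/\ exists m a, gr (t + (a * #|F|)%:Z) m /\ z = loc_frac (xprod K F) m a,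
        ~~ P F -> z = 0 & loc_lin q z = c' F]}.
  apply: cid; have [PF|PF] := boolP (P F); last first.
    exists 0; split=> //; last by rewrite raddf0 c'0.
    by exists 0, 0%N.
  have [m' [a [m't ->]]] := hc' F; have [m mt ->] := q_onto m't.
  by exists (loc_frac _ m a); split=> //; [exists m, a | rewrite loc_linE].
by exists (fun F => sval (lift F)); split=> F; case: (svalP (lift F)).
Qed.

(** Cochains lift in every degree, and injectivity in degrees i and i+1 shows that the lifts satisfy
    the required equations. The conclusion is an equality of predicates, so that it can be rewritten
    inside [a_inv]. *)
Lemma local_cohomology_neq0_eq i :
    (forall F : {set 'I_s}, (i <= #|F|)%N ->
      injective (@loc_lin _ _ _ q (xprod K F))) ->
  local_cohomology_neq0 gr i = local_cohomology_neq0 gr' i.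
Proof.
move=> q_inj; apply/funext => t; apply/propext; split.
- move=> [c [ci hc dc] nbc]; exists (fun F => loc_lin q (c F)).
    split=> [F Fi||G]; first by rewrite ci // raddf0.
      exact: homogeneous_loc_lin.
    by rewrite -cech_d_loc_lin dc raddf0.
  move=> [b' [b'i hb' cb']]; apply: nbc.
  (* In degree i-1 surjectivity is enough: any lift b of b' will do, since c and the differential of
     b have the same image in degree i. *)
  have [b [hb bi bE]] := homogeneous_lift (P := fun F => #|F|.+1 == i) hb' b'i.
  exists b; split=> // G; have [Gi|Gi] := eqVneq #|G| i.
    apply: (@q_inj G); first by rewrite Gi.
    rewrite cech_d_loc_lin cb'; congr (cech_d _ G).
    by apply: functional_extensionality_dep => F; rewrite bE.
  by rewrite ci // (cech_d_in_degree bi).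
- move=> [c' [c'i hc' dc'] nbc'].
  have [F|c [hc ci cE]] := homogeneous_lift (P := fun F => #|F| == i) hc'.
    exact: c'i.
  have {}cE : c' = fun F => loc_lin q (c F).
    by apply: functional_extensionality_dep => F; rewrite cE.
  exists c.
    (* The differential of the lift lives in degree i+1 and has image zero there. *)
    split=> // G; have [Gi|Gi] := eqVneq #|G| i.+1; last first.
      by rewrite (cech_d_in_degree (p := i.+1)).
    apply: (@q_inj G); first by rewrite Gi.
    by rewrite cech_d_loc_lin -cE dc' raddf0.
  move=> [b [bi hb cb]]; apply: nbc'.
  exists (fun F => loc_lin q (b F)); split=> [F Fi||G].
  - by rewrite bi // raddf0.
  - exact: homogeneous_loc_lin.
  - by rewrite cE cb cech_d_loc_lin.
Qed.

End CechComparison.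

(** The kernel of S/J -> S/J' is J'/J; the second hypothesis says that powers of x_F kill its
    elements, so it vanishes after localizing at x_F. *)
Lemma local_cohomology_neq0_quot (K : fieldType) (s : nat)
    (J J' : submodClosed {mpoly K[s]}^o) i : {subset J <= J'} ->
    (forall (F : {set 'I_s}) f, (i <= #|F|)%N -> f \in J' ->
      exists c, xprod K F ^+ c * f \in J) ->
  local_cohomology_neq0 (quot_deg J) i = local_cohomology_neq0 (quot_deg J') i.
Proof.
move=> sub sat; apply: (local_cohomology_neq0_eq (q := quot_map sub)).
- by move=> t; exists 0; [case: t => [d|d] //=; apply: rpred0 | rewrite raddf0].
- by move=> t _ [f ft ->]; exists f => //; apply: quot_mapE.
- move=> t _ [f ft ->]; exists (\pi_(quot_mod J) f); first by exists f.
  by rewrite /= quot_mapE.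
move=> F iF; apply: loc_lin_inj; elim/quotW=> f; rewrite /= quot_mapE.
move=> /quot_pi0/(sat _ _ iF)[c cf].
by exists c; rewrite quot_piZ; apply/quot_pi0.
Qed.

(** * Generated ideals and their powers *)

Section IdealPowers.
Variable A : comNzRingType.

Lemma ideal_gen_min (G : A -> Prop) (J : submodClosed A^o) :
  (forall g, G g -> g \in J) -> {subset ideal_gen G <= J}.
Proof.
move=> GJ f /asboolP[r [a [g [Gg ->]]]].
by apply: rpred_sum => i _; apply: (rpredZ (a i)); apply: GJ.
Qed.

Lemma ideal_gen_mem (G : A -> Prop) g : G g -> g \in ideal_gen G.
Proof.
move=> Gg; apply/asboolP; exists 1%N, (fun=> 1), (fun=> g).
by rewrite big_ord1 mul1r.
Qed.

Lemma ideal_pow_mem (J : {pred A^o}) n (g : 'I_n -> A) :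
  (forall i, g i \in J) -> \prod_(i < n) g i \in ideal_pow J n.
Proof. by move=> gJ; apply: ideal_gen_mem; exists g. Qed.

Lemma ideal_gen_mulr (G H : A -> Prop) (x : A) :
    (forall g, G g -> x * g \in ideal_gen H) ->
  forall f, f \in ideal_gen G -> x * f \in ideal_gen H.
Proof.
move=> GH f /asboolP[r [a [g [Gg ->]]]]; rewrite mulr_sumr.
by apply: rpred_sum => i _; rewrite mulrCA; apply/(rpredZ (a i))/GH.
Qed.

(** Each of the n factors of a generator absorbs one copy of x. *)
Lemma ideal_pow_mulr (J J' : {pred A^o}) (x : A) n :
    (forall f, f \in J -> x * f \in J') ->
  forall f, f \in ideal_pow J n -> x ^+ n * f \in ideal_pow J' n.
Proof.
move=> JJ'; apply: ideal_gen_mulr => _ [g gJ ->].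
rewrite -[n in x ^+ n]card_ord -prodr_const -big_split.
by apply: ideal_pow_mem => i; apply: JJ'.
Qed.

End IdealPowers.

(** * Ordinary and symbolic powers of the Stanley-Reisner ideal *)

Section StanleyReisnerPowers.
Variables (K : fieldType) (s : nat) (D : {set {set 'I_s}}).

(** A non-face F contains a minimal non-face G, and x_G divides x_F. *)
Lemma xprod_stanley_reisner F :
  F \notin D -> xprod K F \in stanley_reisner K D.
Proof.
move=> FD.
have [G Gmin /setIidPr GF] := minset_exists (P := fun G => G \notin D) FD.
rewrite /xprod (big_setID G) GF /= mulrC; apply: rpredZ.
by apply: ideal_gen_mem; exists G; rewrite // inE.
Qed.

(** A non-face G is not contained in the face F, so x_G has a variable x_i with i outside F. *)
Lemma stanley_reisner_sub_facet_prime F : simplicial_complex D -> F \in D ->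
  {subset stanley_reisner K D <= facet_prime K F}.
Proof.
move=> Dc FD; apply: ideal_gen_min => _ [G + ->].
rewrite inE => /minsetp GD.
have /subsetPn[i iG iF] : ~~ (G \subset F) by apply: contraNN GD; apply: Dc.
rewrite /xprod (big_setD1 i) //= mulrC; apply: rpredZ.
by apply: ideal_gen_mem; exists i.
Qed.

Lemma ideal_pow_sub_symbolic n : simplicial_complex D ->
  {subset ideal_pow (stanley_reisner K D) n <= symbolic_power K D n}.
Proof.
move=> Dc f fI; apply/forall_inP => F; rewrite inE => /maxsetp FD.
(* Monotonicity of powers is [ideal_pow_mulr] with x = 1. *)
rewrite -[f]mul1r -(expr1n _ n); apply: ideal_pow_mulr fI => g gI.
by rewrite mul1r; apply: stanley_reisner_sub_facet_prime gI.
Qed.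

Lemma symbolic_power_saturation n (F : {set 'I_s}) f :
    (forall G, G \in D -> (#|G| <= #|F|)%N) -> f \in symbolic_power K D n ->
  xprod K F ^+ n * f \in ideal_pow (stanley_reisner K D) n.
Proof.
move=> Fmax fI.
have [FD|/xprod_stanley_reisner FD] := boolP (F \in D); last first.
  rewrite mulrC; apply: rpredZ.
  by rewrite -[n in _ ^+ n]card_ord -prodr_const; apply: ideal_pow_mem.
have maxF (G : {set 'I_s}) : F \proper G -> G \notin D.
  by move=> /proper_card; rewrite ltnNge; apply/contraNN/Fmax.
(* A face of largest cardinality is a facet, so f lies in P_F^n. *)
have Ffacet : F \in facets D.
  rewrite inE; apply/maxsetP; split=> // G GD FG; apply/eqP.
  by rewrite eq_sym eqEproper FG; apply: contraL GD => /maxF.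
move: fI => /forall_inP/(_ F Ffacet); apply: ideal_pow_mulr.
apply: ideal_gen_mulr => _ [i iF ->].
(* For i outside F, the set i |: F is larger than every face, which gives x_F P_F inside I. *)
have -> : xprod K F * 'X_i = xprod K (i |: F).
  by rewrite /xprod big_setU1 //= mulrC.
by apply/xprod_stanley_reisner/maxF/properUr; rewrite sub1set.
Qed.

End StanleyReisnerPowers.

Theorem theorem3p9 (K : fieldType) (k s : nat) (D : {set {set 'I_s}})
    (k_gt0 : (0 < k)%N) (s_gt0 : (0 < s)%N)
    (D_complex : simplicial_complex D) (D_dim : complex_dim D = k%:Z)
    (n : nat) (n_gt0 : (1 <= n)%N) :
  a_inv (quot_deg (symbolic_power K D n)) k.+1 =
  a_inv (quot_deg (ideal_pow (stanley_reisner K D) n)) k.+1.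
Proof.
(* Dimension is cardinality minus one, so faces have at most k+1 elements. *)
have card_face G : G \in D -> (#|G| <= k.+1)%N.
  move=> GD; have : (face_dim G <= complex_dim D)%R.
    exact: (le_bigmax_cond _ (@face_dim s)).
  by rewrite D_dim /face_dim lerBlDr -PoszD addn1.
(* Unfolded, both sides depend on the module only through the predicate [local_cohomology_neq0]. *)
rewrite /a_inv /a_max.
rewrite (local_cohomology_neq0_quot (ideal_pow_sub_symbolic D_complex)) //.
move=> F f kF fI; exists n; apply: symbolic_power_saturation fI => G GD.
exact: leq_trans (card_face G GD) kF.
Qed.
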